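(* Let $\mathfrak{m}_{\mathbb{B}}=\left\{\begin{pmatrix}0&\overline{q}\\ q&0\end{pmatrix}:q\in\mathbb{H}\right\}$. The map $\pi:\mathrm{Sp}(1)\times\mathfrak{m}_{\mathbb{B}}\times\mathrm{Sp}(1)\to\mathrm{Sp}(1,1)$ given by \[ \pi(u,X,v)=\operatorname{diag}(u,1)\,\exp(X)\,v \] is a diffeomorphism.
   Context: $\mathbb{H}$ denotes the quaternions and $\mathrm{Sp}(1)=\{u\in\mathbb{H}:|u|=1\}$. Let $I_{1,1}=\operatorname{diag}(1,-1)$ and $\mathrm{Sp}(1,1)=\{A\in M_2(\mathbb{H}):A^*I_{1,1}A=I_{1,1}\}$, where $A^*$ is the conjugate transpose. Here $\exp$ is the matrix exponential $\exp(X)=\sum_{k\ge0}X^k/k!$ (which is the Lie group exponential of $\mathrm{Sp}(1,1)$), and in $\pi(u,X,v)$ the element $v\in\mathrm{Sp}(1)$ multiplies the matrix on the right as the scalar matrix $vI_2$. *)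

(* Defs.v *)
From HB Require Import structures.
From mathcomp Require Import all_boot all_order all_algebra.
From mathcomp Require Import all_classical all_reals all_analysis.
Set Implicit Arguments. Unset Strict Implicit. Unset Printing Implicit Defensive.
Import Order.TTheory GRing.Theory Num.Theory.
Import numFieldNormedType.Exports.
Local Open Scope classical_set_scope.
Local Open Scope ring_scope.

Section Quat.
Variable R : realType.

(** Quaternions H = R^4, coordinates (a, b, c, d) <-> a + b i + c j + d k. *)
Definition quat := 'rV[R]_4.
Definition mkq (a b c d : R) : quat := \row_(i < 4) [:: a; b; c; d]`_i.
Definition q0 (p : quat) : R := p ord0 (inord 0).
Definition q1 (p : quat) : R := p ord0 (inord 1).
Definition q2 (p : quat) : R := p ord0 (inord 2).
Definition q3 (p : quat) : R := p ord0 (inord 3).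

Definition qmul (p q : quat) : quat :=
  mkq (q0 p * q0 q - q1 p * q1 q - q2 p * q2 q - q3 p * q3 q)
      (q0 p * q1 q + q1 p * q0 q + q2 p * q3 q - q3 p * q2 q)
      (q0 p * q2 q - q1 p * q3 q + q2 p * q0 q + q3 p * q1 q)
      (q0 p * q3 q + q1 p * q2 q - q2 p * q1 q + q3 p * q0 q).
Definition qconj (p : quat) : quat := mkq (q0 p) (- q1 p) (- q2 p) (- q3 p).
Definition qone : quat := mkq 1 0 0 0.
Definition qnorm2 (p : quat) : R := q0 p ^+ 2 + q1 p ^+ 2 + q2 p ^+ 2 + q3 p ^+ 2.

Definition Sp1 : set quat := [set u | qnorm2 u = 1].

(** 2x2 quaternionic matrices: ((a, b), (c, d)) is the matrix [[a, b], [c, d]]. *)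
Definition M2H := ((quat * quat) * (quat * quat))%type.
Definition mkM (a b c d : quat) : M2H := ((a, b), (c, d)).
Definition e11 (A : M2H) := A.1.1.
Definition e12 (A : M2H) := A.1.2.
Definition e21 (A : M2H) := A.2.1.
Definition e22 (A : M2H) := A.2.2.

Definition mmul (A B : M2H) : M2H :=
  mkM (qmul (e11 A) (e11 B) + qmul (e12 A) (e21 B))
      (qmul (e11 A) (e12 B) + qmul (e12 A) (e22 B))
      (qmul (e21 A) (e11 B) + qmul (e22 A) (e21 B))
      (qmul (e21 A) (e12 B) + qmul (e22 A) (e22 B)).
Definition madj (A : M2H) : M2H :=
  mkM (qconj (e11 A)) (qconj (e21 A)) (qconj (e12 A)) (qconj (e22 A)).
Definition mone : M2H := mkM qone 0 0 qone.
Definition I11 : M2H := mkM qone 0 0 (- qone).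
Definition mscal_r (A : M2H) (v : quat) : M2H :=
  mkM (qmul (e11 A) v) (qmul (e12 A) v) (qmul (e21 A) v) (qmul (e22 A) v).
Definition mdiag (u w : quat) : M2H := mkM u 0 0 w.

Definition Sp11 : set M2H := [set A | mmul (mmul (madj A) I11) A = I11].

Definition mB : set M2H := [set X | exists q : quat, X = mkM 0 (qconj q) q 0].

Definition mpow (X : M2H) (k : nat) : M2H := iter k (mmul X) mone.
Definition mexp (X : M2H) : M2H :=
  limn (fun n : nat => \sum_(k < n) ((k`!)%:R^-1 : R) *: mpow X k).

Definition piB (x : quat * M2H * quat) : M2H :=
  mscal_r (mmul (mdiag x.1.1 qone) (mexp x.1.2)) x.2.

Definition dom_piB : set (quat * M2H * quat) :=
  [set x | Sp1 x.1.1 /\ mB x.1.2 /\ Sp1 x.2].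

(** Smoothness: C^k on an open set of a (finite-dimensional) real normed
    space = all iterated directional derivatives up to order k exist and
    are continuous on U. *)
Fixpoint Ck (V W : normedModType R) (k : nat) (U : set V) (f : V -> W) : Prop :=
  (forall x, U x -> {for x, continuous f}) /\
  match k with
  | 0 => True
  | k'.+1 => forall v : V, (forall x, U x -> derivable f x v) /\ Ck k' U ('D_v f)
  end.

Definition smooth_on (V W : normedModType R) (U : set V) (f : V -> W) : Prop :=
  open U /\ forall k, Ck k U f.

Definition smooth_map (V W : normedModType R) (M : set V) (f : V -> W) : Prop :=
  forall x, M x -> exists U : set V, [/\ open U, U x &
     exists F : V -> W, smooth_on U F /\ forall y, U y -> M y -> F y = f y].

Definition diffeo (V W : normedModType R) (M : set V) (N : set W) (f : V -> W) : Prop :=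
  (forall x, M x -> N (f x)) /\
  exists g : W -> V, [/\ (forall y, N y -> M (g y)),
     (forall x, M x -> g (f x) = x),
     (forall y, N y -> f (g y) = y),
     smooth_map M f & smooth_map N g].

End Quat.

(* Main.v *)
Require Import Defs.
From HB Require Import structures.
From mathcomp Require Import all_boot all_order all_algebra.
From mathcomp Require Import all_classical all_reals all_analysis.
From mathcomp Require Import ring lra.
Set Implicit Arguments. Unset Strict Implicit. Unset Printing Implicit Defensive.
Import Order.TTheory GRing.Theory Num.Theory.
Import numFieldNormedType.Exports.
Local Open Scope classical_set_scope.
Local Open Scope ring_scope.

(* For X = [[0, q*], [q, 0]] one has X^2 = |q|^2, so with t = |q|^2
   exp X = C(t) + S(t) X, where C(t) = cosh (sqrt t) and
   S(t) = sinh (sqrt t) / sqrt t are entire functions of t. Hence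
   pi(u, X, v) = [[C u v, S u q* v], [S q v, C v]]. Conversely, a matrix
   [[a, b], [c, d]] of Sp(1,1) satisfies |a|^2 = |d|^2 = 1 + |c|^2 and
   a* b = c* d; from |c|^2 = t S(t)^2 one recovers t = theta(|c|^2), and then
   u = C^-2 a d*, q = (S C)^-1 c d*, v = C^-1 d. No square root is taken:
   (t S^2)' = S C > 0 on a neighbourhood of [0, +oo[, so theta is smooth there,
   including at 0, and the inverse map is smooth on the whole space of
   matrices. *)

(** * Closure properties of the class [Ck] *)

Section CkCalculus.
Variable R : realType.
Implicit Types V W : normedModType R.

(** By linearity [L] commutes with difference quotients, and by continuity it commutes with their
    limit. *)
Lemma is_derive_linear_comp V W (W' : normedModType R) (L : W -> W')
    (f : V -> W) (x v : V) (df : W) :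
  linear L -> continuous L -> is_derive x v f df ->
  is_derive x v (L \o f) (L df).
Proof.
move=> Llin Lcont [fd <-].
have LB a b : L (a - b) = L a - L b.
  by rewrite addrC -scaleN1r Llin scaleN1r addrC.
have LZ k a : L (k *: a) = k *: L a.
  have L0 : L 0 = 0 by rewrite -(subrr 0) LB subrr.
  by rewrite -[k *: a]addr0 Llin L0 addr0.
have lf : h^-1 *: (((L \o f) \o shift x) (h *: v) - (L \o f) x) @[h --> 0^']
    --> L ('D_v f x).
  under eq_fun do rewrite /= -LB -LZ.
  apply: (@cvg_comp _ _ _ (fun h => h^-1 *: (f (h *: v + x) - f x)) L _ _ _ fd).
  exact: Lcont.
by apply: DeriveDef; [apply/cvg_ex; eexists; exact: lf|exact: (cvg_lim _ lf)].
Qed.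

(** Restricting [f] to the line [h *: v + x] reduces the claim to the chain rule for functions of
    one real variable. *)
Lemma is_derive_comp1 V (phi : R -> R) (f : V -> R) (x v : V) (a b : R) :
  is_derive (f x) 1 phi a -> is_derive x v f b ->
  is_derive x v (phi \o f) (a * b).
Proof.
have line (g : V -> R) d :
    is_derive x v g d <-> is_derive (0 : R) (1 : R) (fun h : R => g (h *: v + x)) d.
  suff E : (fun h : R => h^-1 *: ((g \o shift x) (h *: v) - g x)) =
      (fun h : R => h^-1 *: (((fun h : R => g (h *: v + x)) \o shift (0 : R)) (h *: (1 : R))
         - g (0 *: v + x))).
    by split=> -[gd gv]; apply: DeriveDef; move: gd gv; rewrite /derivable /derive E.
  by apply/funext => h /=; rewrite addr0 scale0r add0r [_%:A]mulr1.
move=> dphi /line df; apply/line.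
by apply: (is_derive1_comp (f := phi) (g := fun h : R => f (h *: v + x)));
   rewrite ?scale0r ?add0r.
Qed.

Lemma Ck_continuous V W k (U : set V) (f : V -> W) :
  Ck k U f -> forall x, U x -> {for x, continuous f}.
Proof. by case: k => [|k] []. Qed.

(** As [U] is open, the two functions agree near each of its points, so continuity and directional
    derivatives carry over at every order. *)
Lemma Ck_ext V W k (U : set V) (f g : V -> W) :
  open U -> (forall x, U x -> f x = g x) -> Ck k U f -> Ck k U g.
Proof.
move=> Uo; elim: k f g => [|k IH] f g fg.
all: have fgn x : U x -> \forall y \near x, f y = g y
  by move=> Ux; near=> y; apply: fg; near: y; exact: open_nbhs_nbhs.
all: have fgc : (forall x, U x -> {for x, continuous f}) ->
    forall x, U x -> {for x, continuous g}
  by move=> fc x Ux; rewrite /prop_for /continuous_at -fg//;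
     apply: cvg_trans (fc x Ux); apply: near_eq_cvg; exact: fgn.
- by move=> [fc _]; split => //; exact: fgc.
- move=> [fc fd]; split; first exact: fgc.
  move=> v; have [fdv Dv] := fd v; split.
    by move=> x Ux; apply: (near_eq_derivable (f := f)) (fdv x Ux); exact: fgn.
  by apply: IH Dv => x Ux; apply: near_eq_derive; exact: fgn.
Unshelve. all: by end_near. Qed.

(** Introduction rule for the inductions on the order below: the derivatives may be given by a
    formula [df] valid on [U] only, instead of the globally defined ['D_v f]. *)
Lemma CkS_is_derive V W k (U : set V) (f : V -> W) (df : V -> V -> W) :
  open U -> (forall x, U x -> {for x, continuous f}) ->
  (forall x v, U x -> is_derive x v f (df v x)) ->
  (forall v, Ck k U (df v)) -> Ck k.+1 U f.
Proof.
move=> Uo fc fd dC; split => // v; split.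
  by move=> x /(fd x v)[].
by apply: (Ck_ext Uo _ (dC v)) => x /(fd x v)[].
Qed.

Lemma CkS_derive V W k (U : set V) (f : V -> W) : Ck k.+1 U f ->
  (forall x v, U x -> is_derive x v f ('D_v f x)) /\ forall v, Ck k U ('D_v f).
Proof.
move=> [_ fd]; split => [x v Ux|v]; last by have [] := fd v.
by apply: derivableP; have [/(_ x Ux)] := fd v.
Qed.

Lemma CkW V W k (U : set V) (f : V -> W) : Ck k.+1 U f -> Ck k U f.
Proof.
elim: k f => [|k IH] f [fc fd]; split => // v.
by have [fdv Dv] := fd v; split => //; exact: IH.
Qed.

Lemma Ck_subset V W k (U U' : set V) (f : V -> W) :
  U `<=` U' -> Ck k U' f -> Ck k U f.
Proof.
move=> UU'; elim: k f => [|k IH] f [fc fd].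
all: have fcU x : U x -> {for x, continuous f} by move=> /UU'; exact: fc.
- by split.
- split => // v; have [fdv Dv] := fd v.
  by split; [move=> x /UU'; exact: fdv|exact: IH].
Qed.

Lemma Ck_cst V W k (U : set V) (w : W) : open U -> Ck k U (cst w : V -> W).
Proof.
move=> Uo; elim: k w => [|k IH] w; first by split => // x _; exact: cst_continuous.
by apply: CkS_is_derive (fun _ => IH 0) => // x _; exact: cst_continuous.
Qed.

Lemma Ck_id V k (U : set V) : open U -> Ck k U (id : V -> V).
Proof.
have idc x : U x -> {for x, continuous (id : V -> V)} by move=> _; exact: cvg_id.
move=> Uo; case: k => [|k]; first by split.
by apply: CkS_is_derive (fun v => Ck_cst k v Uo).
Qed.

Lemma CkD V W k (U : set V) (f g : V -> W) :
  open U -> Ck k U f -> Ck k U g -> Ck k U (fun x => f x + g x).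
Proof.
move=> Uo; elim: k f g => [|k IH] f g fC gC.
all: have c x : U x -> {for x, continuous (fun y => f y + g y)}
  by move=> Ux; apply: continuousD; [exact: Ck_continuous fC _ Ux|
    exact: Ck_continuous gC _ Ux].
- by split.
- have [fd Df] := CkS_derive fC; have [gd Dg] := CkS_derive gC.
  apply: (CkS_is_derive (df := fun v x => 'D_v f x + 'D_v g x)) => //.
    by move=> x v Ux; apply: is_deriveD; [exact: fd|exact: gd].
  by move=> v; exact: IH.
Qed.

Lemma Ck_linear_comp V W (W' : normedModType R) k (U : set V) (L : W -> W')
    (f : V -> W) :
  open U -> linear L -> continuous L -> Ck k U f -> Ck k U (fun x => L (f x)).
Proof.
move=> Uo Ll Lc; elim: k f => [|k IH] f fC.
all: have c x : U x -> {for x, continuous (fun y => L (f y))}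
  by move=> Ux; apply: (continuous_comp (Ck_continuous fC Ux)); exact: Lc.
- by split.
- have [fd Df] := CkS_derive fC.
  apply: (CkS_is_derive (df := fun v x => L ('D_v f x))) => //.
    by move=> x v Ux; apply: is_derive_linear_comp => //; exact: fd.
  by move=> v; exact: IH.
Qed.

(** The product rule brings back [f] and [g] themselves next to their derivatives; [CkW] lowers
    their order so that the induction hypothesis applies. *)
Lemma CkM V k (U : set V) (f g : V -> R) :
  open U -> Ck k U f -> Ck k U g -> Ck k U (fun x => f x * g x).
Proof.
move=> Uo; elim: k f g => [|k IH] f g fC gC.
all: have c x : U x -> {for x, continuous (fun y => f y * g y)}
  by move=> Ux; apply: continuousM; [exact: Ck_continuous fC _ Ux|
    exact: Ck_continuous gC _ Ux].
- by split.
- have [fd Df] := CkS_derive fC; have [gd Dg] := CkS_derive gC.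
  apply: (CkS_is_derive (df := fun v x => f x * 'D_v g x + g x * 'D_v f x)) => //.
    by move=> x v Ux; apply: is_deriveM; [exact: fd|exact: gd].
  by move=> v; apply: CkD => //; apply: IH => //; exact: CkW.
Qed.

Lemma CkN V k (U : set V) (f : V -> R) :
  open U -> Ck k U f -> Ck k U (fun x => - f x).
Proof.
move=> Uo fC; apply: (Ck_ext (f := fun x => (-1) * f x)) => //.
  by move=> x _; rewrite mulN1r.
by apply: CkM => //; exact: (@Ck_cst V R).
Qed.

(** The derivative of 1/f is -(1/f)(1/f) f', so the induction hypothesis for 1/f itself, combined
    with [CkM], gives the next order. *)
Lemma CkV V k (U : set V) (f : V -> R) : open U ->
  (forall x, U x -> f x != 0) -> Ck k U f -> Ck k U (fun x => (f x)^-1).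
Proof.
move=> Uo f0; elim: k => [|k IH] fC.
all: have c x : U x -> {for x, continuous (fun y => (f y)^-1)}
  by move=> Ux; apply: continuousV; [exact: f0|exact: Ck_continuous fC _ Ux].
- by split.
- have [fd Df] := CkS_derive fC.
  apply: (CkS_is_derive
      (df := fun v x => - ((f x)^-1 * (f x)^-1) * 'D_v f x)) => //.
    move=> x v Ux; have [fdx _] := fd x v Ux.
    apply: DeriveDef; first by apply: derivableV => //; exact: f0.
    by rewrite deriveV ?f0// expr2 invfM.
  have VC := IH (CkW fC).
  by move=> v; apply: CkM => //; apply: CkN => //; exact: CkM.
Qed.

(** The induction is over all [phi], since the chain rule replaces [phi] by its derivative. *)
Lemma Ck_comp1 V k (U : set V) (I : set R) (phi : R -> R) (f : V -> R) :
  open U -> (forall x, U x -> I (f x)) -> Ck k I phi -> Ck k U f ->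
  Ck k U (fun x => phi (f x)).
Proof.
move=> Uo UI; elim: k phi => [|k IH] phi pC fC.
all: have c x : U x -> {for x, continuous (fun y => phi (f y))}
  by move=> Ux; apply: (continuous_comp (Ck_continuous fC Ux));
     exact: (Ck_continuous pC (UI _ Ux)).
- by split.
- have [pd Dp] := CkS_derive pC; have [fd Df] := CkS_derive fC.
  apply: (CkS_is_derive (df := fun v x => 'D_1 phi (f x) * 'D_v f x)) => //.
    move=> x v Ux; apply: is_derive_comp1; last exact: fd.
    exact: pd (UI _ Ux).
  by move=> v; apply: CkM => //; exact: IH (Dp (1 : R)) (CkW fC).
Qed.

End CkCalculus.

(** * Power series with exponentially dominated coefficients *)

Section EntireSeries.
Variable R : realType.
Implicit Types c : R^nat.

(** Domination by the Taylor coefficients of A exp(B x) makes the series converge everywhere, and it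
    is stable under termwise differentiation. *)
Definition exp_bounded c :=
  exists A B : R, forall k, `|c k| <= A * (B ^+ k / k`!%:R).

Definition psum c (x : R) : R := limn (pseries c x).

Lemma exp_bounded_diffs c : exp_bounded c -> exp_bounded (pseries_diffs c).
Proof.
move=> [A [B cAB]]; exists (A * B), B => k.
rewrite /pseries_diffs normrM ger0_norm//.
have -> : A * B * (B ^+ k / k`!%:R) =
    k.+1%:R * (A * (B ^+ k.+1 / (k.+1)`!%:R)).
  rewrite factS natrM exprS invfM.
  have : k.+1%:R != 0 :> R by rewrite pnatr_eq0.
  move: (k.+1%:R : R) (k`!%:R^-1 : R) => n f n0.
  by rewrite -[A * B * _](mulKf n0); ring.
by apply: ler_wpM2l.
Qed.

Lemma exp_bounded_cvg c x : exp_bounded c -> cvgn (pseries c x).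
Proof.
move=> [A [B cAB]]; apply: normed_cvg => /=.
apply: (@series_le_cvg _ _ (fun k => A * exp_coeff (B * `|x|) k)).
- by move=> n /=; exact: normr_ge0.
(* No sign is assumed for [A] and [B]; the dominating term is nonnegative because it bounds a
   norm. *)
- move=> n; rewrite /exp_coeff/= exprMn mulrAC mulrA.
  by apply: le_trans (ler_wpM2r (exprn_ge0 n (normr_ge0 x)) (cAB n));
     rewrite mulr_ge0// normr_ge0.
- move=> n; rewrite /= normrM normrX /exp_coeff/= exprMn.
  rewrite [leRHS](_ : _ = A * (B ^+ n / n`!%:R) * `|x| ^+ n); last by ring.
  by rewrite ler_wpM2r// exprn_ge0.
- exact/is_cvg_seriesZ/is_cvg_series_exp_coeff.
Qed.

Lemma is_derive_psum c x v : exp_bounded c ->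
  is_derive x v (psum c) (psum (pseries_diffs c) x * v).
Proof.
move=> cb.
apply: (is_derive_comp1 (phi := psum c) (f := id) _ (is_derive_id x v)).
(* Termwise differentiation at [x] asks for convergence at a point of larger modulus; [|x| + 1] will
   do. *)
apply: (@pseries_snd_diffs _ _ (`|x| + 1)).
- exact: exp_bounded_cvg.
- exact/exp_bounded_cvg/exp_bounded_diffs.
- exact/exp_bounded_cvg/exp_bounded_diffs/exp_bounded_diffs.
- by rewrite [ltRHS]ger0_norm ?addr_ge0// ltrDl.
Qed.

(** The derivative is a series of the same class times a constant, so induction over all coefficient
    sequences gives every order. *)
Lemma Ck_psum c k : exp_bounded c -> Ck k setT (psum c).
Proof.
have psum_cont c' x : exp_bounded c' -> {for x, continuous (psum c')}.
  move=> cb; apply: differentiable_continuous; apply/derivable1_diffP.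
  by have [] := is_derive_psum x 1 cb.
elim: k c => [|k IH] c cb; first by split => // x _; exact: psum_cont.
apply: CkS_is_derive => [||x v _|v].
- exact: openT.
- by move=> x _; exact: psum_cont.
- exact: is_derive_psum.
- apply: CkM; [exact: openT|exact/IH/exp_bounded_diffs|].
  exact/(@Ck_cst R R R)/openT.
Qed.

(** All terms are nonnegative, so each nonempty partial sum is at least its first term. *)
Lemma psum_ge c x : exp_bounded c -> (forall k, 0 <= c k) -> 0 <= x ->
  c 0 <= psum c x.
Proof.
move=> cb c0 x0; apply: limr_ge; first exact: exp_bounded_cvg.
near=> n; have : (0 < n)%N by near: n; exists 1%N.
move=> n0; rewrite -(prednK n0) /pseries/series/= big_nat_recl// expr0 mulr1 lerDl.
by apply: sumr_ge0 => i _; rewrite mulr_ge0// exprn_ge0.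
Unshelve. all: by end_near. Qed.

Lemma psum_at0 c : psum c 0 = c 0.
Proof.
apply/cvg_lim => //; rewrite -cvg_shiftS.
apply: cvg_near_cst; apply: nearW => n.
rewrite /pseries/series/= big_nat_recl// expr0 mulr1 big1_seq ?addr0// => i _.
by rewrite expr0n/= mulr0.
Qed.

End EntireSeries.

(** * The entire functions cosh(sqrt t) and sinh(sqrt t) / sqrt t *)

Section HyperbolicSeries.
Variable R : realType.

Definition cosh_coef : R^nat := fun k => (k.*2)`!%:R^-1.
Definition sinh_coef : R^nat := fun k => (k.*2.+1)`!%:R^-1.

(* [hcosh t] is cosh (sqrt t) and [hsinh t] is sinh (sqrt t) / sqrt t. *)
Definition hcosh : R -> R := psum cosh_coef.
Definition hsinh : R -> R := psum sinh_coef.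

Let inv_fact_le m n : (m <= n)%N -> n`!%:R^-1 <= m`!%:R^-1 :> R.
Proof.
move=> mn; rewrite lef_pV2 ?posrE ?ltr0n ?fact_gt0// ler_nat.
exact: leq_fact.
Qed.

Lemma cosh_coef_bounded : exp_bounded cosh_coef.
Proof.
exists 1, 1 => k; rewrite expr1n !mul1r ger0_norm ?invr_ge0//.
by apply: inv_fact_le; rewrite -addnn leq_addr.
Qed.

Lemma sinh_coef_bounded : exp_bounded sinh_coef.
Proof.
exists 1, 1 => k; rewrite expr1n !mul1r ger0_norm ?invr_ge0//.
by apply: inv_fact_le; rewrite -addnn -addnS leq_addr.
Qed.

Lemma hcosh_ge1 t : 0 <= t -> 1 <= hcosh t.
Proof.
move=> t0; have -> : 1 = cosh_coef 0 by rewrite /cosh_coef/= invr1.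
apply: psum_ge => //; first exact: cosh_coef_bounded.
by move=> k; rewrite invr_ge0.
Qed.

Lemma hsinh_ge1 t : 0 <= t -> 1 <= hsinh t.
Proof.
move=> t0; have -> : 1 = sinh_coef 0 by rewrite /sinh_coef/= invr1.
apply: psum_ge => //; first exact: sinh_coef_bounded.
by move=> k; rewrite invr_ge0.
Qed.

(** Termwise, (k+1) / (2k+2)! = 1 / (2 (2k+1)!). *)
Lemma is_derive_hcosh t : is_derive t (1 : R) hcosh (hsinh t / 2).
Proof.
have := is_derive_psum t 1 cosh_coef_bounded; rewrite mulr1.
suff -> : psum (pseries_diffs cosh_coef) t = hsinh t / 2 by [].
apply/cvg_lim => //.
have -> : pseries (pseries_diffs cosh_coef) t = (fun n => pseries sinh_coef t n / 2).
  apply/funext => n; rewrite /pseries/series/= mulr_suml; apply: eq_bigr => i _.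
  rewrite /pseries_diffs /cosh_coef /sinh_coef doubleS factS natrM invfM.
  have -> : i.*2.+2%:R = 2 * i.+1%:R :> R by rewrite -natrM mul2n doubleS.
  have : i.+1%:R != 0 :> R by rewrite pnatr_eq0.
  move: (i.+1%:R : R) ((i.*2.+1)`!%:R^-1 : R) => m f m0.
  by rewrite invfM -[in RHS](mulKf m0 f); ring.
by apply: cvgMr_tmp; exact/exp_bounded_cvg/sinh_coef_bounded.
Qed.

(** Termwise, 1 / (2i)! = (1 + 2i) / (2i+1)!. This expresses the derivative of [hsinh] without
    dividing by [t], so [t = 0] is covered. *)
Lemma hcoshE t : hcosh t = hsinh t + 2 * t * psum (pseries_diffs sinh_coef) t.
Proof.
apply/cvg_lim => //.
(* The terms of the derived series with the index unshifted, to match those of [hcosh] one by one;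
   the truncated exponent at [i = 0] is harmless, as the factor [i] kills that term. *)
pose s i := i%:R * sinh_coef i * t ^+ i.-1.
have -> : pseries cosh_coef t =
    (fun n => pseries sinh_coef t n + 2 * t * series s n).
  apply/funext => n; rewrite /pseries/series/= mulr_sumr -big_split/=.
  apply: eq_bigr => i _.
  rewrite /s /cosh_coef /sinh_coef factS natrM invfM -mul2n.
  case: i => [|i]; first by rewrite muln0 expr0 !mulr1 !mul0r mulr0 addr0 invr1 mulr1.
  rewrite exprS/= -natr1 natrM.
  field; rewrite pnatr_eq0 -lt0n fact_gt0/=.
  by rewrite (_ : _ + 1 = (2 * i.+1).+1%:R) ?pnatr_eq0//; ring.
have dcvg := @exp_bounded_cvg _ _ t (exp_bounded_diffs sinh_coef_bounded).
apply: (cvgD (@exp_bounded_cvg _ _ t sinh_coef_bounded)).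
exact: (cvgMl_tmp (pseries_diffs_equiv dcvg)).
Qed.

Lemma is_derive_hsinh t :
  exists2 d, is_derive t (1 : R) hsinh d & hcosh t = hsinh t + 2 * t * d.
Proof.
exists (psum (pseries_diffs sinh_coef) t); last exact: hcoshE.
by have := is_derive_psum t 1 sinh_coef_bounded; rewrite mulr1.
Qed.

(** By the product rule the derivative is S^2 + 2 t S S' = S (S + 2 t S'), which is S C by
    [hcoshE]. *)
Lemma is_derive_hsinh_sq t :
  is_derive t (1 : R) (fun x => x * hsinh x ^+ 2) (hsinh t * hcosh t).
Proof.
have [d sd ->] := is_derive_hsinh t.
have -> : (fun x => x * hsinh x ^+ 2) = (id : R -> R) * (hsinh * hsinh).
  by apply/funext => x; rewrite expr2.
by apply: is_derive_eq; rewrite /GRing.scale/= mulrfctE; ring.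
Qed.

(** This is cosh^2 - sinh^2 = 1: the difference of the two squares has derivative 2 C (S / 2) - S C
    = 0 and equals 1 at 0. *)
Lemma hcosh_sq t : hcosh t ^+ 2 = 1 + t * hsinh t ^+ 2.
Proof.
apply/eqP; rewrite -subr_eq; apply/eqP.
pose g : R -> R := hcosh * hcosh - (fun x => x * hsinh x ^+ 2).
have gd x : is_derive x (1 : R) g 0.
  have cd := is_derive_hcosh x; have sd := is_derive_hsinh_sq x.
  by apply: is_derive_eq; rewrite /GRing.scale/=; field.
have := is_derive_0_is_cst t 0 gd.
rewrite /g !fctE mul0r subr0 -expr2 => ->.
by rewrite /hcosh psum_at0 /cosh_coef invr1 mulr1.
Qed.

End HyperbolicSeries.

(** * Smooth inversion of t S(t)^2 *)

Section InverseFunction.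
Variable R : realType.

Lemma is_derive1_continuous (f : R -> R) (x d : R) :
  is_derive x (1 : R) f d -> {for x, continuous f}.
Proof.
by move=> [fd _]; apply: differentiable_continuous; exact/derivable1_diffP.
Qed.

(** Bootstrap on theta' = 1 / g(theta): if [theta] is C^k, so is the right-hand side, hence [theta]
    is C^(k+1). *)
Lemma Ck_inverse (I J : set R) (f g theta : R -> R) :
  open I -> open J ->
  (forall s, J s -> I (theta s) /\ f (theta s) = s) ->
  (forall t, I t -> theta (f t) = t) ->
  (forall t, I t -> is_derive t (1 : R) f (g t) /\ g t != 0) ->
  (forall k, Ck k I g) -> forall k, Ck k J theta.
Proof.
move=> Io Jo thI thK fd gC.
have thd s : J s -> is_derive s (1 : R) theta (g (theta s))^-1.
  move=> Js; have [Is {1}<-] := thI s Js.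
  have In : \forall t \near theta s, I t by exact: open_nbhs_nbhs.
  apply: is_derive_inverse.
  - by near=> t; apply: thK; near: t.
  - near=> t; have [fdt _] : is_derive t (1 : R) f (g t) /\ g t != 0.
      by apply: fd; near: t.
    exact: is_derive1_continuous fdt.
  - by have [] := fd _ Is.
  - by have [] := fd _ Is.
have thc s : J s -> {for s, continuous theta}.
  by move=> /thd; exact: is_derive1_continuous.
elim=> [|k IH]; first by split.
apply: (CkS_is_derive (df := fun v s => (g (theta s))^-1 * v)) => //.
  move=> s v Js.
  exact: (is_derive_comp1 (phi := theta) (f := id) (thd s Js) (is_derive_id s v)).
move=> v; apply: CkM => //; last exact: (@Ck_cst R R R).
apply: CkV => //; first by move=> s /thI[Is _]; have [] := fd _ Is.
by apply: (Ck_comp1 (I := I)) => // s /thI[].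
Unshelve. all: by end_near. Qed.

(* [t * hsinh t ^+ 2] is sinh (sqrt t) ^ 2. Its derivative [hsinh * hcosh] is
   positive for [t >= 0], hence also for slightly negative [t], which is what
   makes the inverse smooth at 0. *)
Lemma hsinh_sq_inverse : exists (theta : R -> R) (J : set R),
  [/\ open J, (forall s, 0 <= s -> J s), (forall k, Ck k J theta),
    (forall s, 0 <= s -> 0 <= theta s /\ theta s * hsinh (theta s) ^+ 2 = s) &
    (forall t, 0 <= t -> theta (t * hsinh t ^+ 2) = t)].
Proof.
pose f (t : R) := t * hsinh t ^+ 2; pose g (t : R) := hsinh t * hcosh t.
have fd t : is_derive t (1 : R) f (g t) by exact: is_derive_hsinh_sq.
have fc t : {for t, continuous f} by exact: is_derive1_continuous (fd t).
have gC k : Ck k setT g.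
  by apply: CkM; [exact: openT|apply: Ck_psum; exact: sinh_coef_bounded|
    apply: Ck_psum; exact: cosh_coef_bounded].
have g0 t : 0 <= t -> 0 < g t.
  by move=> t0; rewrite mulr_gt0// (lt_le_trans ltr01)// (hsinh_ge1, hcosh_ge1).
(* Continuity at 0 gives positivity on a ball of radius [d]; taking [e = d / 2] keeps the endpoint
   [- e] inside the ball. *)
have [e e0 ge] : exists2 e : R, 0 < e & forall t, - e <= t -> 0 < g t.
  have : \forall x \near (0 : R), 0 < g x.
    have gc0 := Ck_continuous (gC 0%N) (I : setT (0 : R)).
    exact: (cvgr_gt _ gc0 _ (g0 0 (lexx _))).
  move=> /nbhs_ballP[d /= d0 dg]; exists (d / 2); first by rewrite divr_gt0.
  move=> t td; have [/g0//|t0] := leP 0 t; apply: dg.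
  by rewrite /ball/= sub0r normrN ltr0_norm//; lra.
have f_mono a b : - e <= a -> a < b -> f a < f b.
  move=> ea ab; have [c cab fE] := @MVT R f g a b ab (fun x _ => fd x)
    (continuous_subspaceT fc).
  rewrite -subr_gt0 fE mulr_gt0 ?subr_gt0//; apply: ge.
  by move: cab; rewrite in_itv/= => /andP[/ltW + _]; exact: le_trans.
have f_inj a b : - e <= a -> - e <= b -> f a = f b -> a = b.
  by move=> ea eb fab; have [/(f_mono _ _ ea)|/(f_mono _ _ eb)|//] := ltgtP a b;
     rewrite fab ltxx.
have f_ge t : 0 <= t -> t <= f t.
  by move=> t0; rewrite ler_peMr// exprn_ege1// hsinh_ge1.
have f00 : f 0 = 0 by rewrite /f mul0r.
pose I := [set t | - e < t]; pose J := [set s | f (- e) < s].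
(* The intermediate value theorem on [- e, max(s, 0)] yields [t], because f(max(s, 0)) >= max(s, 0)
   >= s. Outside [J] nothing is required, and 0 is a default. *)
have /choice[theta thP] s : exists t, J s -> I t /\ f t = s.
  have [Js|nJs] := pselect (J s); last by exists 0.
  have em : - e <= Num.max s 0 by rewrite le_max [- e <= 0]lerNl oppr0 (ltW e0) orbT.
  have fm : s <= f (Num.max s 0).
    by apply: le_trans (f_ge _ _); rewrite le_max lexx ?orbT.
  have [||t] := @IVT R f (- e) (Num.max s 0) s em.
  - exact: continuous_subspaceT.
  - by rewrite ge_min le_max (ltW Js) fm orbT.
  rewrite in_itv/= => /andP[et _] ft; exists t => _; split => //.
  by rewrite /I/= lt_neqAle et andbT; apply: contraTneq Js => ->; rewrite -ft /J/= ltxx.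
have thK t : I t -> theta (f t) = t.
  move=> et; have [|eth fth] := thP (f t); first exact: f_mono.
  by apply: f_inj => //; exact: ltW.
have J0 s : 0 <= s -> J s.
  by move=> s0; apply: lt_le_trans s0; rewrite -f00; apply: f_mono; rewrite // oppr_lt0.
exists theta, J; split => //.
- apply: (@Ck_inverse I J f g) => // [t /ltW /ge gt0|k].
    by split => //; rewrite gt_eqF.
  exact: Ck_subset (gC k).
- move=> s s0; have [eth fth] := thP s (J0 s s0); split => //.
  (* A negative [theta s] would give s = f(theta s) < f(0) = 0. *)
  rewrite leNgt; apply/negP => th0.
  by have := f_mono _ _ (ltW eth) th0; rewrite fth f00 ltNge s0.
- by move=> t t0; apply: thK; rewrite /I/=; lra.
Qed.

End InverseFunction.

(** * Quaternion identities and equations for Sp(1,1) *)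

Section QuaternionAlgebra.
Variable R : realType.
Implicit Types (p q r u v : quat R) (k a b c d : R).

Lemma quatP p q : q0 p = q0 q -> q1 p = q1 q -> q2 p = q2 q -> q3 p = q3 q ->
  p = q.
Proof.
move=> h0 h1 h2 h3; apply/rowP => -[i i4].
case: i i4 => [|[|[|[|//]]]] i4.
- by move: h0; rewrite /q0 (_ : inord 0 = Ordinal i4)//; apply: val_inj; rewrite /= inordK.
- by move: h1; rewrite /q1 (_ : inord 1 = Ordinal i4)//; apply: val_inj; rewrite /= inordK.
- by move: h2; rewrite /q2 (_ : inord 2 = Ordinal i4)//; apply: val_inj; rewrite /= inordK.
- by move: h3; rewrite /q3 (_ : inord 3 = Ordinal i4)//; apply: val_inj; rewrite /= inordK.
Qed.

Lemma mkq_coord a b c d : [/\ q0 (mkq a b c d) = a, q1 (mkq a b c d) = b,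
  q2 (mkq a b c d) = c & q3 (mkq a b c d) = d].
Proof. by split; rewrite /q0 /q1 /q2 /q3 mxE inordK. Qed.

Lemma q0_mkq a b c d : q0 (mkq a b c d) = a. Proof. by have [] := mkq_coord a b c d. Qed.
Lemma q1_mkq a b c d : q1 (mkq a b c d) = b. Proof. by have [] := mkq_coord a b c d. Qed.
Lemma q2_mkq a b c d : q2 (mkq a b c d) = c. Proof. by have [] := mkq_coord a b c d. Qed.
Lemma q3_mkq a b c d : q3 (mkq a b c d) = d. Proof. by have [] := mkq_coord a b c d. Qed.

Lemma q0_linear : linear (@q0 R). Proof. by move=> k p q; rewrite /q0 !mxE. Qed.
Lemma q1_linear : linear (@q1 R). Proof. by move=> k p q; rewrite /q1 !mxE. Qed.
Lemma q2_linear : linear (@q2 R). Proof. by move=> k p q; rewrite /q2 !mxE. Qed.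
Lemma q3_linear : linear (@q3 R). Proof. by move=> k p q; rewrite /q3 !mxE. Qed.

Lemma qcoord0 : [/\ q0 (0 : quat R) = 0, q1 (0 : quat R) = 0,
  q2 (0 : quat R) = 0 & q3 (0 : quat R) = 0].
Proof. by split; rewrite /q0 /q1 /q2 /q3 mxE. Qed.

Lemma qcoordD p q : [/\ q0 (p + q) = q0 p + q0 q, q1 (p + q) = q1 p + q1 q,
  q2 (p + q) = q2 p + q2 q & q3 (p + q) = q3 p + q3 q].
Proof. by split; rewrite /q0 /q1 /q2 /q3 mxE. Qed.

Lemma qcoordN p : [/\ q0 (- p) = - q0 p, q1 (- p) = - q1 p,
  q2 (- p) = - q2 p & q3 (- p) = - q3 p].
Proof. by split; rewrite /q0 /q1 /q2 /q3 mxE. Qed.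

Lemma qcoordZ k p : [/\ q0 (k *: p) = k * q0 p, q1 (k *: p) = k * q1 p,
  q2 (k *: p) = k * q2 p & q3 (k *: p) = k * q3 p].
Proof. by split; rewrite /q0 /q1 /q2 /q3 mxE. Qed.

(** A single multirule for all coordinates, with which [qring] turns an identity between
    noncommuting quaternions into four identities in the commutative ring [R]. *)
Definition q_coordE :=
  (q0_mkq, q1_mkq, q2_mkq, q3_mkq,
   (fun p q => let: And4 h _ _ _ := qcoordD p q in h),
   (fun p q => let: And4 _ h _ _ := qcoordD p q in h),
   (fun p q => let: And4 _ _ h _ := qcoordD p q in h),
   (fun p q => let: And4 _ _ _ h := qcoordD p q in h),
   (fun p => let: And4 h _ _ _ := qcoordN p in h),
   (fun p => let: And4 _ h _ _ := qcoordN p in h),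
   (fun p => let: And4 _ _ h _ := qcoordN p in h),
   (fun p => let: And4 _ _ _ h := qcoordN p in h),
   (fun k p => let: And4 h _ _ _ := qcoordZ k p in h),
   (fun k p => let: And4 _ h _ _ := qcoordZ k p in h),
   (fun k p => let: And4 _ _ h _ := qcoordZ k p in h),
   (fun k p => let: And4 _ _ _ h := qcoordZ k p in h),
   (let: And4 h _ _ _ := qcoord0 in h), (let: And4 _ h _ _ := qcoord0 in h),
   (let: And4 _ _ h _ := qcoord0 in h), (let: And4 _ _ _ h := qcoord0 in h)).

Ltac qring :=
  apply: quatP; rewrite /qmul /qconj /qone /qnorm2 !q_coordE; ring.

Lemma qmulA p q r : qmul p (qmul q r) = qmul (qmul p q) r. Proof. qring. Qed.
Lemma qmul1r p : qmul (qone R) p = p. Proof. qring. Qed.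
Lemma qmulr1 p : qmul p (qone R) = p. Proof. qring. Qed.
Lemma qmul0r p : qmul 0 p = 0. Proof. qring. Qed.
Lemma qmulr0 p : qmul p 0 = 0. Proof. qring. Qed.
Lemma qmulrN p q : qmul p (- q) = - qmul p q. Proof. qring. Qed.
Lemma qmulNr p q : qmul (- p) q = - qmul p q. Proof. qring. Qed.
Lemma qmulZl k p q : qmul (k *: p) q = k *: qmul p q. Proof. qring. Qed.
Lemma qmulZr k p q : qmul p (k *: q) = k *: qmul p q. Proof. qring. Qed.
Lemma qconjK p : qconj (qconj p) = p. Proof. qring. Qed.
Lemma qconjM p q : qconj (qmul p q) = qmul (qconj q) (qconj p). Proof. qring. Qed.
Lemma qconjZ k p : qconj (k *: p) = k *: qconj p. Proof. qring. Qed.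
Lemma qmul_conjl p : qmul (qconj p) p = qnorm2 p *: qone R. Proof. qring. Qed.
Lemma qmul_conjr p : qmul p (qconj p) = qnorm2 p *: qone R. Proof. qring. Qed.

Lemma qnorm2M p q : qnorm2 (qmul p q) = qnorm2 p * qnorm2 q.
Proof. by rewrite /qnorm2 /qmul !q_coordE; ring. Qed.

Lemma qnorm2_conj p : qnorm2 (qconj p) = qnorm2 p.
Proof. by rewrite /qnorm2 /qconj !q_coordE; ring. Qed.

Lemma qnorm2Z k p : qnorm2 (k *: p) = k ^+ 2 * qnorm2 p.
Proof. by rewrite /qnorm2 !q_coordE; ring. Qed.

Lemma qnorm2_ge0 p : 0 <= qnorm2 p.
Proof. by rewrite /qnorm2 !addr_ge0// sqr_ge0. Qed.

(** These are the diagonal entries and the upper right entry of the defining equation; its lower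
    left entry is the conjugate of the upper right one. *)
Lemma Sp11P (A : M2H R) : Sp11 A <->
  [/\ qnorm2 (e11 A) = 1 + qnorm2 (e21 A), qnorm2 (e22 A) = 1 + qnorm2 (e12 A) &
    qmul (qconj (e11 A)) (e12 A) = qmul (qconj (e21 A)) (e22 A)].
Proof.
move: A => [[a b] [c d]]; rewrite /Sp11/= /mmul /madj /I11 /mkM.
rewrite /e11 /e12 /e21 /e22 /= !qmulr1 !qmulr0 !addr0 !add0r !qmulrN !qmulr1 !qmulNr.
rewrite !qmul_conjl; split.
- move=> [/(congr1 (@q0 R)) h1 h2 _ /(congr1 (@q0 R)) h4].
  move: h1 h4; rewrite /qone !q_coordE => h1 h4; split; [lra|lra|].
  by apply/eqP; rewrite -subr_eq0 h2.
- move=> [h1 h2 h3]; congr ((_, _), (_, _)).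
  + by rewrite h1; qring.
  + by rewrite h3 subrr.
  + have := congr1 (@qconj R) h3; rewrite !qconjM !qconjK => ->.
    by rewrite subrr.
  + by rewrite h2; qring.
Qed.

(** Taking norms in a* b = c* d gives (1 + |c|^2) |b|^2 = |c|^2 (1 + |b|^2), hence |b| = |c|. *)
Lemma Sp11_norms (A : M2H R) : Sp11 A ->
  qnorm2 (e12 A) = qnorm2 (e21 A) /\ qnorm2 (e22 A) = qnorm2 (e11 A).
Proof.
move=> /Sp11P[ha hd /(congr1 (@qnorm2 R))].
rewrite !qnorm2M !qnorm2_conj ha hd => h.
have -> : qnorm2 (e12 A) = qnorm2 (e21 A) by lra.
by split.
Qed.

End QuaternionAlgebra.

(** * The exponential on [mB] in closed form *)

Section MatrixExponential.
Variable R : realType.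

Lemma mkMZ (k : R) (a b c d : quat R) :
  k *: mkM a b c d = mkM (k *: a) (k *: b) (k *: c) (k *: d).
Proof. by []. Qed.

Lemma mkMD (a b c d a' b' c' d' : quat R) :
  mkM a b c d + mkM a' b' c' d' = mkM (a + a') (b + b') (c + c') (d + d').
Proof. by []. Qed.

Lemma mmul_mkM (a b c d a' b' c' d' : quat R) :
  mmul (mkM a b c d) (mkM a' b' c' d') =
  mkM (qmul a a' + qmul b c') (qmul a b' + qmul b d')
      (qmul c a' + qmul d c') (qmul c b' + qmul d d').
Proof. by []. Qed.

(** Since X^2 = t, even powers of X are multiples of the identity and odd powers are multiples of X;
    splitting the exponential series by parity leaves the series of [hcosh] and [hsinh] at [t]. *)
Lemma mexp_mB (q : quat R) : let t := qnorm2 q in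
  mexp (mkM 0 (qconj q) q 0) =
  mkM (hcosh t *: qone R) (hsinh t *: qconj q) (hsinh t *: q) (hcosh t *: qone R).
Proof.
move=> t; set X := mkM _ _ _ _.
have XZ k : mmul X (k *: mone R) = k *: X.
  rewrite /X /mone !mkMZ mmul_mkM !qmul0r !qmulZr !qmulr1 !qmulr0.
  by rewrite !scaler0 !addr0 !add0r.
have XX k : mmul X (k *: X) = (k * t) *: mone R.
  rewrite /X /mone !mkMZ mmul_mkM !qmul0r !qmulZr !qmulr0 !scaler0 !addr0 !add0r.
  by rewrite qmul_conjl qmul_conjr -/t !scalerA.
have Xpow m : mpow X m.*2 = t ^+ m *: mone R /\ mpow X m.*2.+1 = t ^+ m *: X.
  elim: m => [|m [_ IH]]; first by rewrite /mpow/= expr0 -[X in mmul _ X]scale1r XZ !scale1r.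
  have E : mpow X m.+1.*2 = t ^+ m.+1 *: mone R.
    by rewrite doubleS /mpow iterS -/(mpow X m.*2.+1) IH XX -exprSr.
  by split => //; rewrite /mpow iterS -/(mpow X m.+1.*2) E XZ.
pose C m := pseries (@cosh_coef R) t m; pose S m := pseries (@sinh_coef R) t m.
pose P n := \sum_(0 <= k < n) ((k`!)%:R^-1 : R) *: mpow X k.
have P2 m : P m.*2 = C m *: mone R + S m *: X.
  rewrite /P /C /S /pseries/series/=; elim: m => [|m IH].
    by rewrite !big_nil !scale0r addr0.
  rewrite doubleS !big_nat_recr// IH.
  have [-> ->] := Xpow m; rewrite !scalerDl /cosh_coef /sinh_coef !scalerA.
  by rewrite /= -addrA addrACA.
have P2S m : P m.*2.+1 = C m.+1 *: mone R + S m *: X.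
  rewrite /P big_nat_recr// -/(P m.*2) P2 /C /pseries/series/= big_nat_recr//=.
  have [-> _] := Xpow m; rewrite scalerDl /cosh_coef scalerA.
  by rewrite addrAC.
(* Among the exponents below [n], [uphalf n] are even and [n./2] are odd; both counts tend to
   infinity with [n]. *)
have PE n : P n = C (uphalf n) *: mone R + S n./2 *: X.
  rewrite -(odd_double_half n); case: (odd n).
    by rewrite add1n P2S /= uphalf_double doubleK.
  by rewrite add0n P2 uphalf_double doubleK.
have halfy : half @ \oo --> \oo.
  apply/cvgnyPge => A; exists A.*2 => // n /= An.
  by rewrite -(doubleK A) half_leq.
have uphalfy : uphalf @ \oo --> \oo.
  apply/cvgnyPge => A; exists A.*2 => // n /= An.
  by rewrite -(uphalf_double A) uphalf_leq.
have Ccvg : C (uphalf n) @[n --> \oo] --> hcosh t.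
  exact: cvg_comp uphalfy (@exp_bounded_cvg _ _ t (@cosh_coef_bounded R)).
have Scvg : S n./2 @[n --> \oo] --> hsinh t.
  exact: cvg_comp halfy (@exp_bounded_cvg _ _ t (@sinh_coef_bounded R)).
rewrite [LHS](_ : _ = hcosh t *: mone R + hsinh t *: X); last first.
  apply/cvg_lim; first exact: norm_hausdorff.
  rewrite [X in X @ _ --> _](_ : _ = fun n => C (uphalf n) *: mone R + S n./2 *: X).
    by apply: cvgD; apply: cvgZr_tmp.
  by apply/funext => n; rewrite -PE /P big_mkord.
by rewrite /X /mone !mkMZ mkMD !scaler0 !addr0 !add0r.
Qed.

Lemma piB_mB (u q v : quat R) : let t := qnorm2 q in
  piB (u, mkM 0 (qconj q) q 0, v) =
  mkM (hcosh t *: qmul u v) (hsinh t *: qmul (qmul u (qconj q)) v)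
      (hsinh t *: qmul q v) (hcosh t *: v).
Proof.
move=> t; rewrite /piB /= mexp_mB -/t /mscal_r /mmul /mdiag /mkM.
rewrite /e11 /e12 /e21 /e22 /= !qmul0r !qmul1r !addr0 !add0r.
by rewrite !qmulZr !qmulZl !qmulr1 !qmul1r.
Qed.

End MatrixExponential.

(** * Smoothness of quaternionic and matrix operations *)

Section SmoothQuaternions.
Variables (R : realType) (V : normedModType R) (U : set V) (k : nat).
Hypothesis Uo : open U.

Lemma Ck_scalel (W : normedModType R) (f : V -> R) (w : W) :
  Ck k U f -> Ck k U (fun x => f x *: w).
Proof.
apply: (Ck_linear_comp (L := fun a : R => a *: w)) => //.
  by move=> a b c; rewrite scalerDl scalerA.
exact: scalel_continuous.
Qed.

(** The pair is (f, 0) + (0, g), a sum of images under continuous linear embeddings. *)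
Lemma Ck_pair (W W' : normedModType R) (f : V -> W) (g : V -> W') :
  Ck k U f -> Ck k U g -> Ck k U (fun x => (f x, g x)).
Proof.
move=> fC gC; apply: (Ck_ext (f := fun x => (f x, 0) + (0, g x))) => //.
  by move=> x _; congr (_, _); rewrite ?addr0 ?add0r.
apply: CkD => //.
  apply: (Ck_linear_comp (L := fun a => (a, 0))) => //.
    move=> r a b; apply/pair_equal_spec; split => //.
    by rewrite -[LHS](scaler0 W' r) -[LHS]addr0.
  by move=> x; apply: cvg_pair; [exact: cvg_id|exact: cvg_cst].
apply: (Ck_linear_comp (L := fun a => (0, a))) => //.
  move=> r a b; apply/pair_equal_spec; split => //.
  by rewrite -[LHS](scaler0 W r) -[LHS]addr0.
by move=> x; apply: cvg_pair; [exact: cvg_cst|exact: cvg_id].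
Qed.

Lemma Ck_fst (W W' : normedModType R) (f : V -> W * W') :
  Ck k U f -> Ck k U (fun x => (f x).1).
Proof. by apply: (Ck_linear_comp (L := fst)) => // x; exact: cvg_fst. Qed.

Lemma Ck_snd (W W' : normedModType R) (f : V -> W * W') :
  Ck k U f -> Ck k U (fun x => (f x).2).
Proof. by apply: (Ck_linear_comp (L := snd)) => // x; exact: cvg_snd. Qed.

Lemma Ck_qcoord (f : V -> quat R) : Ck k U f ->
  [/\ Ck k U (fun x => q0 (f x)), Ck k U (fun x => q1 (f x)),
      Ck k U (fun x => q2 (f x)) & Ck k U (fun x => q3 (f x))].
Proof.
move=> fC; split.
- by apply: (Ck_linear_comp (L := @q0 R)) fC => //; [exact: q0_linear|exact: coord_continuous].
- by apply: (Ck_linear_comp (L := @q1 R)) fC => //; [exact: q1_linear|exact: coord_continuous].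
- by apply: (Ck_linear_comp (L := @q2 R)) fC => //; [exact: q2_linear|exact: coord_continuous].
- by apply: (Ck_linear_comp (L := @q3 R)) fC => //; [exact: q3_linear|exact: coord_continuous].
Qed.

(** Expansion in the basis 1, i, j, k reduces this to scalar functions times fixed vectors. *)
Lemma Ck_mkq (a b c d : V -> R) :
  Ck k U a -> Ck k U b -> Ck k U c -> Ck k U d ->
  Ck k U (fun x => mkq (a x) (b x) (c x) (d x)).
Proof.
move=> aC bC cC dC; apply: (Ck_ext (f := fun x => a x *: mkq 1 0 0 0 +
  b x *: mkq 0 1 0 0 + c x *: mkq 0 0 1 0 + d x *: mkq 0 0 0 1)) => //.
  by move=> x _; apply: quatP; rewrite !q_coordE; ring.
by do !apply: CkD => //; exact: Ck_scalel.
Qed.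

Lemma Ck_qmul (f g : V -> quat R) :
  Ck k U f -> Ck k U g -> Ck k U (fun x => qmul (f x) (g x)).
Proof.
move=> /Ck_qcoord[f0 f1 f2 f3] /Ck_qcoord[g0 g1 g2 g3].
by apply: Ck_mkq; repeat first [exact: CkM | apply: CkN | apply: CkD].
Qed.

Lemma Ck_qconj (f : V -> quat R) : Ck k U f -> Ck k U (fun x => qconj (f x)).
Proof.
by move=> /Ck_qcoord[f0 f1 f2 f3]; apply: Ck_mkq => //; exact: CkN.
Qed.

Lemma Ck_qnorm2 (f : V -> quat R) : Ck k U f -> Ck k U (fun x => qnorm2 (f x)).
Proof.
move=> /Ck_qcoord[f0 f1 f2 f3].
by rewrite /qnorm2; repeat first [exact: CkM | apply: CkD].
Qed.

Lemma Ck_qscale (f : V -> R) (g : V -> quat R) :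
  Ck k U f -> Ck k U g -> Ck k U (fun x => f x *: g x).
Proof.
move=> fC /Ck_qcoord[g0 g1 g2 g3].
apply: (Ck_ext (f := fun x =>
  mkq (f x * q0 (g x)) (f x * q1 (g x)) (f x * q2 (g x)) (f x * q3 (g x)))) => //.
  by move=> x _; apply: quatP; rewrite !q_coordE.
by apply: Ck_mkq; exact: CkM.
Qed.

Lemma Ck_mkM (a b c d : V -> quat R) :
  Ck k U a -> Ck k U b -> Ck k U c -> Ck k U d ->
  Ck k U (fun x => mkM (a x) (b x) (c x) (d x)).
Proof. by move=> *; apply: Ck_pair; exact: Ck_pair. Qed.

End SmoothQuaternions.

(** * Smooth extensions of the map and of its inverse *)

Section Inverse.
Variable R : realType.

Lemma smooth_map_setT (V W : normedModType R) (M : set V) (f F : V -> W) :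
  (forall k, Ck k setT F) -> (forall x, M x -> F x = f x) -> smooth_map M f.
Proof.
move=> FC Ff x Mx; exists setT; split => //; first exact: openT.
by exists F; split; [split => //; exact: openT|move=> y _; exact: Ff].
Qed.

(** Reading q off as the lower left entry of X makes the closed form of [piB] meaningful on the
    whole ambient space, where its smoothness can be checked without differentiating the limit in
    [mexp]. *)
Definition piB_ext (x : quat R * M2H R * quat R) : M2H R :=
  let u := x.1.1 in let q := e21 x.1.2 in let v := x.2 in
  mkM (hcosh (qnorm2 q) *: qmul u v)
      (hsinh (qnorm2 q) *: qmul (qmul u (qconj q)) v)
      (hsinh (qnorm2 q) *: qmul q v) (hcosh (qnorm2 q) *: v).

Lemma piB_extE x : dom_piB x -> piB_ext x = piB x.
Proof.
by move: x => [[u X] v] [/= _ [[q ->] _]]; rewrite piB_mB.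
Qed.

Lemma Ck_piB_ext k : Ck k setT piB_ext.
Proof.
have To : open (setT : set (quat R * M2H R * quat R)) by exact: openT.
have idC := Ck_id k To.
have uC := Ck_fst To (Ck_fst To idC).
have qC := Ck_fst To (Ck_snd To (Ck_snd To (Ck_fst To idC))).
have vC := Ck_snd To idC.
have hc : Ck k setT (fun x : quat R * M2H R * quat R => hcosh (qnorm2 (e21 x.1.2))).
  apply: (Ck_comp1 (I := setT)) => //; last exact: Ck_qnorm2.
  exact/Ck_psum/cosh_coef_bounded.
have hs : Ck k setT (fun x : quat R * M2H R * quat R => hsinh (qnorm2 (e21 x.1.2))).
  apply: (Ck_comp1 (I := setT)) => //; last exact: Ck_qnorm2.
  exact/Ck_psum/sinh_coef_bounded.
apply: Ck_mkM => //; apply: Ck_qscale => //.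
- exact: Ck_qmul.
- by apply: Ck_qmul => //; apply: Ck_qmul => //; exact: Ck_qconj.
- exact: Ck_qmul.
Qed.

(** If d = C v with |v| = 1, then a = C u v gives a d* = C^2 u, and c = S q v gives c d* = S C q. *)
Definition piB_inv (theta : R -> R) (A : M2H R) : quat R * M2H R * quat R :=
  let c := hcosh (theta (qnorm2 (e21 A))) in
  let s := hsinh (theta (qnorm2 (e21 A))) in
  let q := (s * c)^-1 *: qmul (e21 A) (qconj (e22 A)) in
  ((c * c)^-1 *: qmul (e11 A) (qconj (e22 A)), mkM 0 (qconj q) q 0,
   c^-1 *: e22 A).

(** For every matrix, |c|^2 >= 0 lies in [J] and [theta] is nonnegative there, so C and S are at
    least 1 and no denominator vanishes. *)
Lemma Ck_piB_inv (theta : R -> R) (J : set R) k :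
  (forall s, 0 <= s -> J s) -> Ck k J theta ->
  (forall s, 0 <= s -> 0 <= theta s) -> Ck k setT (piB_inv theta).
Proof.
move=> J0 thC th0.
have To : open (setT : set (M2H R)) by exact: openT.
have idC : Ck k setT (id : M2H R -> M2H R) := Ck_id k To.
have aC := Ck_fst To (Ck_fst To idC).
have cC := Ck_fst To (Ck_snd To idC).
have dC := Ck_snd To (Ck_snd To idC).
have tC : Ck k setT (fun A : M2H R => theta (qnorm2 (e21 A))).
  apply: (Ck_comp1 (I := J)) => //; last exact: Ck_qnorm2.
  by move=> A _; exact/J0/qnorm2_ge0.
have hc : Ck k setT (fun A : M2H R => hcosh (theta (qnorm2 (e21 A)))).
  by apply: (Ck_comp1 (I := setT)) => //; exact/Ck_psum/cosh_coef_bounded.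
have hs : Ck k setT (fun A : M2H R => hsinh (theta (qnorm2 (e21 A)))).
  by apply: (Ck_comp1 (I := setT)) => //; exact/Ck_psum/sinh_coef_bounded.
have c0 (A : M2H R) : hcosh (theta (qnorm2 (e21 A))) != 0.
  by rewrite gt_eqF// (lt_le_trans ltr01)// hcosh_ge1// th0// qnorm2_ge0.
have s0 (A : M2H R) : hsinh (theta (qnorm2 (e21 A))) != 0.
  by rewrite gt_eqF// (lt_le_trans ltr01)// hsinh_ge1// th0// qnorm2_ge0.
have qC : Ck k setT (fun A : M2H R => (hsinh (theta (qnorm2 (e21 A))) *
    hcosh (theta (qnorm2 (e21 A))))^-1 *: qmul (e21 A) (qconj (e22 A))).
  apply: Ck_qscale => //; last by apply: Ck_qmul => //; exact: Ck_qconj.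
  by apply: CkV => //; [move=> A _; rewrite mulf_neq0|exact: CkM].
apply: Ck_pair => //; first apply: Ck_pair => //.
- apply: Ck_qscale => //; last by apply: Ck_qmul => //; exact: Ck_qconj.
  by apply: CkV => //; [move=> A _; rewrite mulf_neq0|exact: CkM].
- by apply: Ck_mkM => //; [exact: Ck_cst|exact: Ck_qconj|exact: Ck_cst].
- by apply: Ck_qscale => //; exact: CkV.
Qed.

(** The norm equations reduce to C^2 = 1 + t S^2, and both a* b and c* d equal S C v* q* v. *)
Lemma piB_Sp11 (x : quat R * M2H R * quat R) : dom_piB x -> Sp11 (piB x).
Proof.
move: x => [[u X] v] [/= u1 [[q ->] v1]]; rewrite piB_mB; apply/Sp11P.
rewrite /e11 /e12 /e21 /e22 /=; rewrite !qnorm2Z !qnorm2M qnorm2_conj u1 v1.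
have h := hcosh_sq (qnorm2 q).
split; [lra|lra|].
rewrite !qconjZ !qmulZl !qmulZr !qconjM !scalerA mulrC.
rewrite -!qmulA (qmulA (qconj u)) qmul_conjl u1 scale1r qmul1r.
by congr (_ *: _).
Qed.

Lemma piB_invK (theta : R -> R) (x : quat R * M2H R * quat R) :
  (forall t, 0 <= t -> theta (t * hsinh t ^+ 2) = t) ->
  dom_piB x -> piB_inv theta (piB x) = x.
Proof.
move=> thK; move: x => [[u X] v] [/= u1 [[q ->] v1]]; rewrite piB_mB.
have t0 := qnorm2_ge0 q.
rewrite /piB_inv /e11 /e21 /e22 /= qnorm2Z qnorm2M v1 mulr1 [hsinh _ ^+ 2 * _]mulrC thK//.
have c0 : hcosh (qnorm2 q) != 0.
  by rewrite gt_eqF// (lt_le_trans ltr01)// hcosh_ge1.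
have s0 : hsinh (qnorm2 q) != 0.
  by rewrite gt_eqF// (lt_le_trans ltr01)// hsinh_ge1.
rewrite !qconjZ !qmulZl !qmulZr -!qmulA qmul_conjr v1 scale1r !qmulr1 !scalerA.
by rewrite !qconjZ !scalerA !mulVf ?mulf_neq0// !scale1r.
Qed.

Lemma piB_inv_dom_K (theta : R -> R) (A : M2H R) :
  (forall s, 0 <= s -> 0 <= theta s /\ theta s * hsinh (theta s) ^+ 2 = s) ->
  Sp11 A -> dom_piB (piB_inv theta A) /\ piB (piB_inv theta A) = A.
Proof.
move=> thP SA; have [nb nd] := Sp11_norms SA; have /Sp11P[na _ ab] := SA.
move: A SA nb nd na ab => [[a b] [c d]] _; rewrite /piB_inv /e11 /e12 /e21 /e22 /=.
move=> nb nd na ab; have [t0 tc] := thP _ (qnorm2_ge0 c).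
move: t0 tc; set t := theta _ => t0 tc.
(* This becomes C^2 = |a|^2, which is also |d|^2; hence the recovered u and v are unit
   quaternions. *)
have ch := hcosh_sq t; rewrite tc -na in ch.
have c0 : hcosh t != 0 by rewrite gt_eqF// (lt_le_trans ltr01)// hcosh_ge1.
have s0 : hsinh t != 0 by rewrite gt_eqF// (lt_le_trans ltr01)// hsinh_ge1.
split.
  split; first by rewrite /Sp1/= qnorm2Z qnorm2M qnorm2_conj nd -ch; field.
  split; first by eexists.
  by rewrite /Sp1/= qnorm2Z nd -ch; field.
rewrite piB_mB qnorm2Z qnorm2M qnorm2_conj nd -ch -tc.
(* The recovered q satisfies |q|^2 = t, so [piB] evaluates C and S at the same point as
   [piB_inv]. *)
have -> : (hsinh t * hcosh t)^-1 ^+ 2 * (t * hsinh t ^+ 2 * hcosh t ^+ 2) = t.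
  by field; rewrite s0 c0.
(* In the upper right entry, d* d = C^2 and c* d = a* b turn a d* d c* d into C^2 a a* b = C^4 b;
   the first column needs only d* d = C^2. *)
rewrite !qconjZ !qmulZl !qmulZr !qconjM qconjK -!qmulA qmul_conjl nd -ch.
rewrite !qmulZl -!qmulA (qmulA (qconj d)) qmul_conjl nd -ch -ab qmulZl qmul1r !qmulZr qmulr1.
rewrite qmulA qmul_conjr -ch qmulZl qmul1r !qmulr1 !scalerA.
rewrite /mkM; congr ((_, _), (_, _)); rewrite -[RHS]scale1r; congr (_ *: _);
  by field; rewrite ?s0 ?c0.
Qed.

End Inverse.

Theorem theorem3p14 (R : realType) :
  diffeo (@dom_piB R) (@Sp11 R) (@piB R).
Proof.
have [theta [J [Jo J0 thC thP thK]]] := hsinh_sq_inverse R.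
split; first exact: piB_Sp11.
exists (piB_inv theta); split.
- by move=> A /(piB_inv_dom_K thP)[].
- by move=> x; exact: piB_invK.
- by move=> A /(piB_inv_dom_K thP)[].
- by apply: (smooth_map_setT (F := @piB_ext R)); [exact: Ck_piB_ext|exact: piB_extE].
- apply: (smooth_map_setT (F := piB_inv theta)) => // k.
  by apply: (Ck_piB_inv (J := J)) => // s /thP[].
Qed.
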